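(* Let $d,m,n$ be positive integers with $m\ge 2$ and $n\geq d+1$, let $\mu$ be an arbitrary probability distribution on $\mathbb{R}^d$, and let $Z_1,\ldots,Z_n$ be i.i.d. with distribution $\mu$, $\boldsymbol{Z}=(Z_1,\dots,Z_n)$. Then for every $\delta\in(0,1)$, with probability at least $1-\delta$ (over $\boldsymbol{Z}$), simultaneously for all codebooks $C=(x_1,\ldots,x_m)\in(\mathbb{R}^d)^m$ and all positive-definite matrices $S\in\mathbb{S}_+^d$, \[ \left|P_e^{\mu}(C,S)-P_e^{\boldsymbol{Z}}(C,S)\right|\leq 4m\sqrt{\frac{2(d+1)\log\left(\frac{en}{d+1}\right)}{n}}+\sqrt{\frac{2\log(2/\delta)}{n}}. \]
   Context: For a positive-definite $d\times d$ matrix $S$ (the set of these is $\mathbb{S}_+^d$) and $v\in\mathbb{R}^d$, write $\|v\|_S^2=v^TSv$. For a codebook $C=(x_1,\ldots,x_m)$, $S\in\mathbb{S}_+^d$, $j\in[m]=\{1,\dots,m\}$ and $z\in\mathbb{R}^d$ define the loss \[\ell_j(C,S,z)=\mathbb{I}\Big[\min_{j'\in[m],\,j'\neq j}\big(\|x_j-x_{j'}\|_S^2+2(x_j-x_{j'})^TSz\big)<0\Big],\qquad \ell(C,S,z)=\frac1m\sum_{j=1}^m\ell_j(C,S,z),\] which is the error indicator of the minimum Mahalanobis-distance decoder $\hat j(y)\in\arg\min_j\|x_j-y\|_S$ over the additive noise channel $Y=x_j+z$ when codeword $j$ (chosen uniformly) is sent. The expected average error probability is $P_e^{\mu}(C,S)=\mathbb{E}_{Z\sim\mu}[\ell(C,S,Z)]$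 and the empirical average error probability is $P_e^{\boldsymbol{Z}}(C,S)=\frac1n\sum_{i=1}^n\ell(C,S,Z_i)$. *)

(* Defs.v *)
From HB Require Import structures.
From mathcomp Require Import all_boot all_order all_algebra.
From mathcomp Require Import all_classical all_reals all_analysis.
Set Implicit Arguments. Unset Strict Implicit. Unset Printing Implicit Defensive.
Import Order.TTheory GRing.Theory Num.Theory.
Local Open Scope classical_set_scope.
Local Open Scope ring_scope.

(* R^d for the noise is modelled as [d.-tuple R], which carries the product
   (Borel) sigma-algebra of the library; it is converted to a column vector. *)
Definition tcol (R : realType) (d : nat) (z : d.-tuple R) : 'cV[R]_d :=
  \col_(i < d) tnth z i.

Definition bilin (R : realType) (d : nat) (S : 'M[R]_d) (v w : 'cV[R]_d) : R :=
  ((v^T *m S *m w) 0 0).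

Definition sqnormS (R : realType) (d : nat) (S : 'M[R]_d) (v : 'cV[R]_d) : R :=
  bilin S v v.

Definition posdef (R : realType) (d : nat) (S : 'M[R]_d) : Prop :=
  S^T = S /\ (forall v : 'cV[R]_d, v != 0 -> 0 < sqnormS S v).

(* ell_j(C,S,z) = I[ min_{j' <> j} ( ||x_j - x_j'||_S^2 + 2 (x_j - x_j')^T S z ) < 0 ];
   the minimum over the finite nonempty set {j' <> j} is negative iff some term is. *)
Definition loss_j (R : realType) (d m : nat) (C : 'I_m -> 'cV[R]_d)
    (S : 'M[R]_d) (j : 'I_m) (z : d.-tuple R) : R :=
  ([exists j' : 'I_m, (j' != j) &&
     (sqnormS S (C j - C j') + 2 * bilin S (C j - C j') (tcol z) < 0)] : bool)%:R.

Definition loss (R : realType) (d m : nat) (C : 'I_m -> 'cV[R]_d)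
    (S : 'M[R]_d) (z : d.-tuple R) : R :=
  m%:R^-1 * \sum_(j < m) loss_j C S j z.

Definition Pe_mu (R : realType) (d m : nat) (mu : probability (d.-tuple R) R)
    (C : 'I_m -> 'cV[R]_d) (S : 'M[R]_d) : R :=
  Rintegral mu setT (fun z => loss C S z).

Definition Pe_emp (R : realType) (d m n : nat) (Zs : 'I_n -> d.-tuple R)
    (C : 'I_m -> 'cV[R]_d) (S : 'M[R]_d) : R :=
  n%:R^-1 * \sum_(i < n) loss C S (Zs i).

(* Z_1,...,Z_n (random variables on (T,P)) are i.i.d. with law mu:
   each is measurable, each has distribution mu, and they are mutually
   independent (product rule for every family of measurable sets; taking
   B i = setT gives every subfamily). *)
Definition iid_with_law (R : realType) (d n : nat) (dT : measure_display)
    (T : measurableType dT) (P : probability T R) (mu : probability (d.-tuple R) R)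
    (Z : 'I_n -> T -> d.-tuple R) : Prop :=
  (forall i, measurable_fun setT (Z i)) /\
  (forall i (B : set (d.-tuple R)), measurable B -> P (Z i @^-1` B) = mu B) /\
  (forall B : 'I_n -> set (d.-tuple R), (forall i, measurable (B i)) ->
     fine (P (\bigcap_(i in [set: 'I_n]) (Z i @^-1` B i))) =
     \prod_(i < n) fine (P (Z i @^-1` B i))).

(* Main.v *)
Require Import Defs.
From HB Require Import structures.
From mathcomp Require Import all_boot all_order all_algebra.
From mathcomp Require Import all_classical all_reals all_analysis.
From mathcomp Require Import measurable_realfun.
From mathcomp Require Import lra ring.
Set Implicit Arguments. Unset Strict Implicit. Unset Printing Implicit Defensive.
Import Order.TTheory GRing.Theory Num.Theory.
Import numFieldNormedType.Exports.

(** Each [loss_j] is the indicator of a union of at most [m] open halfspaces, so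
    it suffices to bound the empirical deviation uniformly over such unions.
    Halfspaces with rational parameters approximate all of them pointwise, which
    reduces the claim to a countable family and, by continuity from below, to
    finite families.  For a finite family only the finitely many atoms it
    generates matter, so the problem lives on a finite probability space.  There,
    symmetrization is applied to the exponential moment directly: Jensen's
    inequality introduces a ghost sample, random swaps of the two samples bring
    in random signs, and [cosh x <= exp (x^2/2)] gives the tail
    [2 G exp (- n eps^2 / 2)], where [G] bounds the number of traces of the family
    on [2n] points.  The Sauer-Shelah lemma gives
    [G <= (2 e n / (d+1))^((d+1) m)], which the first term of the bound
    absorbs, while the second one produces exactly [delta / 2]. *)

Local Open Scope set_scope.
Local Open Scope ring_scope.

(** * Exponential symmetrization on a finite probability space *)

Lemma ge0_derivative_le (R : realType) (f df : R -> R) :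
  (forall x : R, is_derive x 1 f (df x)) -> (forall x, 0 <= x -> 0 <= df x) ->
  forall x, 0 <= x -> f 0 <= f x.
Proof.
move=> fE df0 x x0.
have der y : derivable f y 1 by have [] := fE y.
apply: (@ger0_derive1_ndecry _ f 0) => // [y|].
  rewrite in_itv/= andbT => /ltW y0.
  by rewrite derive1E (@derive_val _ _ _ _ _ _ _ (fE y)) df0.
apply: continuous_subspaceT => y.
exact/differentiable_continuous/derivable1_diffP.
Qed.

(** After dividing by [expR (x ^+ 2 / 2)], the left side decreases on nonnegative reals. Its
    negative [h] has derivative [expR (- (y ^+ 2 / 2)) * q y], where [q 0 = 0] and [q] has
    derivative [y * (expR y - expR (- y))]. *)
Lemma expR_addN_le (R : realType) (x : R) :
  expR x + expR (- x) <= 2 * expR (x ^+ 2 / 2).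
Proof.
wlog x0 : x / 0 <= x.
  move=> H; have [/H//|/ltW x0] := leP 0 x.
  by have := H (- x); rewrite opprK sqrrN addrC oppr_ge0; apply.
pose q (y : R) : R := (1 + y) * expR (- y) - (1 - y) * expR y.
have q0 (y : R) : 0 <= y -> 0 <= q y.
  move=> y0; have -> : 0 = q 0 by rewrite /q oppr0 expR0; ring.
  apply: (@ge0_derivative_le _ _ (fun y => y * (expR y - expR (- y)))) => //.
    move=> z; rewrite /q; apply: is_derive_eq; rewrite /GRing.scale /=; ring.
  move=> z z0; rewrite mulr_ge0// subr_ge0 ler_expR; lra.
pose h (y : R) : R := - ((expR y + expR (- y)) * expR (- (y ^+ 2 / 2))).
have : h 0 <= h x.
  apply: (@ge0_derivative_le _ _ (fun y => expR (- (y ^+ 2 / 2)) * q y)) => //.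
    move=> z; rewrite /h /q; apply: is_derive_eq; rewrite /GRing.scale /=; by field.
  by move=> z z0; rewrite mulr_ge0 ?expR_ge0// q0.
rewrite /h lerN2 oppr0 expr0n/= mul0r oppr0 expR0 mulr1 [expR (- (_ / _))]expRN.
by rewrite ler_pdivrMr ?expR_gt0// -[1 + 1]/2.
Qed.

(** The tangent line to [expR] at the mean [a] lies below [expR], and its average is [expR a]. *)
Lemma jensen_expR (R : realType) (E : finType) (p u : E -> R) :
  (forall e, 0 <= p e) -> \sum_e p e = 1 ->
  expR (\sum_e p e * u e) <= \sum_e p e * expR (u e).
Proof.
move=> p0 p1; set a := \sum_e p e * u e.
apply: (@le_trans _ _ (\sum_e p e * (expR a * (1 + (u e - a))))).
  rewrite le_eqVlt; apply/orP; left; apply/eqP.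
  rewrite (eq_bigr (fun e => expR a * (1 - a) * p e + expR a * (p e * u e))).
    by rewrite big_split/= -!mulr_sumr -/a p1; ring.
  by move=> e _; ring.
apply: ler_sum => e _; apply: ler_wpM2l => //.
rewrite -[X in _ <= expR X](subrKC a) expRD ler_wpM2l ?expR_ge0// expR_ge1Dx//.
Qed.

Section symmetrization.
Variables (R : realType) (E K : finType) (p : E -> R) (f : K -> E -> bool) (n : nat).
Hypotheses (p_ge0 : forall e, 0 <= p e) (p_sum1 : \sum_e p e = 1) (n_gt0 : (0 < n)%N).

Definition deviation (k : K) (x : {ffun 'I_n -> E}) : R :=
  n%:R^-1 * \sum_i (f k (x i))%:R - \sum_e p e * (f k e)%:R.

Definition traces (J : finType) (y : {ffun J -> E}) : {set {set J}} :=
  [set [set j | f k (y j)] | k : K].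

(** Index set of the double sample: [true] marks the original points, [false] their ghost twins. *)
Let J := ('I_n * bool)%type.

Let join (x x' : {ffun 'I_n -> E}) : {ffun J -> E} :=
  [ffun j => if j.2 then x j.1 else x' j.1].

Let swap (s : {ffun 'I_n -> bool}) (j : J) : J := (j.1, j.2 (+) s j.1).

Let swapK s : involutive (swap s).
Proof. by case=> i b; rewrite /swap/= -addbA addbb addbF. Qed.

(** The exponential moment sees an event only through its trace [A] on the double sample. This is
    what lets a union bound run over traces instead of over [K]. *)
Let g (lam : R) (A : {set J}) : R :=
  expR (\sum_i lam / n%:R * (((i, true) \in A)%:R - ((i, false) \in A)%:R)).

Let sum_join (F : {ffun J -> E} -> R) :
  \sum_(x : {ffun 'I_n -> E}) \sum_(x' : {ffun 'I_n -> E}) F (join x x') =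
  \sum_y F y.
Proof.
rewrite pair_big/= [RHS](reindex (fun xx => join xx.1 xx.2))//=.
exists (fun y : {ffun J -> E} =>
  ([ffun i => y (i, true)], [ffun i => y (i, false)])) => [[x x']|y] _ /=.
  by congr (_, _); apply/ffunP => i; rewrite !ffunE.
by apply/ffunP => -[i []]; rewrite !ffunE.
Qed.

Let prod_join (x x' : {ffun 'I_n -> E}) :
  \prod_j p (join x x' j) = \prod_i p (x i) * \prod_i p (x' i).
Proof.
rewrite (eq_bigr (fun j : J => p (join x x' (j.1, j.2)))); last by move=> [].
rewrite -(pair_bigA _ (fun i b => p (join x x' (i, b))))/= -big_split/=.
by apply: eq_bigr => i _; rewrite big_bool/= !ffunE.
Qed.

(** The exponential is a product over sample points, so Jensen applies to each factor separately.
    Expanding the product of sums then produces the sum over ghost samples. *)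
Let ghost_sample (lam : R) k (x : {ffun 'I_n -> E}) :
  expR (lam * deviation k x) <=
  \sum_(x' : {ffun 'I_n -> E}) (\prod_i p (x' i)) *
     g lam [set j | f k (join x x' j)].
Proof.
set mean := \sum_e p e * (f k e)%:R.
have n0 : n%:R != 0 :> R by rewrite pnatr_eq0 -lt0n.
have -> : lam * deviation k x =
    \sum_i lam / n%:R * ((f k (x i))%:R - mean).
  rewrite -mulr_sumr sumrB sumr_const card_ord -mulr_natr /deviation -/mean.
  by field.
rewrite expR_sum.
apply: (@le_trans _ _ (\prod_(i < n) \sum_e p e *
    expR (lam / n%:R * ((f k (x i))%:R - (f k e)%:R)))).
  apply: ler_prod => i _; rewrite expR_ge0/=.
  have -> : lam / n%:R * ((f k (x i))%:R - mean) =
      \sum_e p e * (lam / n%:R * ((f k (x i))%:R - (f k e)%:R)).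
    under eq_bigr do rewrite mulrCA.
    rewrite -mulr_sumr; congr (_ * _).
    under eq_bigr do rewrite mulrBr.
    by rewrite sumrB -mulr_suml p_sum1 mul1r.
  exact: jensen_expR.
rewrite bigA_distr_bigA/=; apply: ler_sum => x' _.
rewrite big_split/= /g expR_sum ler_wpM2l ?prodr_ge0// le_eqVlt; apply/orP; left.
by apply/eqP; apply: eq_bigr => i _; rewrite !inE !ffunE.
Qed.

(** Exchanging twins permutes the double samples, preserves the product weight, and carries the
    traces on [y] bijectively to those on the swapped sample. *)
Let sum_swap (lam : R) s :
  \sum_(y : {ffun J -> E}) (\prod_j p (y j)) * \sum_(A in traces y) g lam A =
  \sum_(y : {ffun J -> E}) (\prod_j p (y j)) *
    \sum_(A in traces y) g lam (swap s @^-1: A).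
Proof.
have sY : involutive (fun y : {ffun J -> E} => [ffun j => y (swap s j)]).
  by move=> y; apply/ffunP => j; rewrite !ffunE swapK.
have sA : involutive (fun A : {set J} => swap s @^-1: A).
  by move=> A; apply/finset.setP => j; rewrite !inE swapK.
rewrite (reindex_inj (inv_inj sY))/=; apply: eq_bigr => y _.
congr (_ * _).
  rewrite [RHS](reindex_inj (inv_inj (@swapK s)))/=.
  by apply: eq_bigr => j _; rewrite ffunE.
rewrite (reindex_inj (inv_inj sA))/=; apply: eq_bigl => A.
apply/imsetP/imsetP => -[k _ Ak]; exists k => //.
  by rewrite -[A]sA Ak; apply/finset.setP => j; rewrite !inE ffunE swapK.
by rewrite Ak; apply/finset.setP => j; rewrite !inE ffunE.
Qed.

(** The sum factors over [i]. With [a = lam / n], a factor is 2 when the twins agree on membership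
    in [A], and [expR a + expR (- a)] otherwise; both are at most [2 * expR (a ^+ 2 / 2)]. *)
Let sum_signs (lam : R) (A : {set J}) :
  \sum_(s : {ffun 'I_n -> bool}) g lam (swap s @^-1: A) <=
  2 ^+ n * expR (lam ^+ 2 / (2 * n%:R)).
Proof.
have n0 : n%:R != 0 :> R by rewrite pnatr_eq0 -lt0n.
rewrite (eq_bigr (fun s : {ffun 'I_n -> bool} => \prod_i
   expR (lam / n%:R * (((i, ~~ s i) \in A)%:R - ((i, s i) \in A)%:R)))); last first.
  by move=> s _; rewrite /g expR_sum; apply: eq_bigr => i _; rewrite !inE.
rewrite -(bigA_distr_bigA (fun i b =>
   expR (lam / n%:R * (((i, ~~ b) \in A)%:R - ((i, b) \in A)%:R))))/=.
have -> : 2 ^+ n * expR (lam ^+ 2 / (2 * n%:R)) =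
    \prod_(i < n) (2 * expR ((lam / n%:R) ^+ 2 / 2)) :> R.
  rewrite prodr_const card_ord exprMn -expRM_natr; congr (_ * expR _).
  by field.
apply: ler_prod => i _; rewrite big_bool/= addr_ge0 ?expR_ge0//=.
set a := lam / n%:R.
case: (_ \in A); case: (_ \in A); rewrite ?subrr ?subr0 ?sub0r ?mulrN ?mulr0 ?mulr1;
  do ?[exact: expR_addN_le | by rewrite addrC; exact: expR_addN_le];
  by rewrite expR0 [leRHS]mulrC ler_peMl// -expR0 ler_expR;
     rewrite divr_ge0// sqr_ge0.
Qed.

(** Both signs of [lam] are allowed, so that upper and lower deviations follow from the same
    statement. The growth bound is asked only at atoms of positive mass, since only these are sure
    to come from actual points. *)
Lemma symmetrization_tail (lam c G : R) :
  (forall y : {ffun 'I_n * bool -> E}, (forall j, 0 < p (y j)) ->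
     #|traces y|%:R <= G) ->
  \sum_(x : {ffun 'I_n -> E} | [exists k, c <= lam * deviation k x])
     \prod_i p (x i) <= expR (- c) * G * expR (lam ^+ 2 / (2 * n%:R)).
Proof.
move=> growth.
pose W (y : {ffun J -> E}) := \prod_j p (y j).
have W0 y : 0 <= W y by rewrite prodr_ge0.
pose M y := \sum_(A in traces y) g lam A.
have g0 A : 0 <= g lam A by exact: expR_ge0.
have M0 y : 0 <= M y by rewrite sumr_ge0.
have W1 : \sum_y W y = 1.
  by rewrite -(bigA_distr_bigA (fun _ : J => p))/= big1.
(* Markov's inequality for the exponential: when some [k] is bad, its ghost bound is a single term
   of the nonnegative sum [M]. *)
apply: (@le_trans _ _ (expR (- c) * \sum_y W y * M y)).
  rewrite -(sum_join (fun y => W y * M y)) mulr_sumr big_mkcond/=; apply: ler_sum => x _.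
  have WJ x' : W (join x x') = \prod_i p (x i) * \prod_i p (x' i) by exact: prod_join.
  rewrite (eq_bigr (fun x' : {ffun 'I_n -> E} =>
    \prod_i p (x i) * (\prod_i p (x' i) * M (join x x')))); last first.
    by move=> x' _; rewrite WJ mulrA.
  rewrite -mulr_sumr mulrCA; case: ifPn => [/existsP[k ck]|_]; last first.
    rewrite mulr_ge0 ?prodr_ge0// mulr_ge0 ?expR_ge0// sumr_ge0// => x' _.
    by rewrite mulr_ge0 ?prodr_ge0.
  rewrite -[leLHS]mulr1 ler_wpM2l ?prodr_ge0// expRN mulrC ler_pdivlMr ?expR_gt0//.
  rewrite mul1r; apply: (@le_trans _ _ (expR (lam * deviation k x))).
    by rewrite ler_expR.
  apply: (le_trans (ghost_sample _ _ _)); apply: ler_sum => x' _.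
  rewrite ler_wpM2l ?prodr_ge0//.
  have kT : [set j | f k (join x x' j)] \in traces (join x x').
    by apply/imsetP; exists k.
  by rewrite /M (bigD1 _ kT)/= lerDl sumr_ge0.
rewrite -mulrA ler_wpM2l ?expR_ge0//.
(* The factor [2 ^+ n] counts the swaps; each of them leaves the total unchanged, so the total can
   be replaced by a sum over all sign patterns. *)
rewrite -(ler_pM2l (_ : 0 < 2 ^+ n :> R)) ?exprn_gt0//.
have -> : 2 ^+ n * \sum_y W y * M y =
    \sum_y W y * \sum_(A in traces y) \sum_(s : {ffun 'I_n -> bool})
        g lam (swap s @^-1: A).
  transitivity (\sum_(s : {ffun 'I_n -> bool}) \sum_y W y * M y).
    rewrite sumr_const card_ffun card_bool card_ord -[RHS]mulr_natl.
    by rewrite natrX.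
  rewrite (eq_bigr (fun s => \sum_y W y *
    \sum_(A in traces y) g lam (swap s @^-1: A))); last first.
    by move=> s _; exact: sum_swap.
  rewrite exchange_big/=; apply: eq_bigr => y _.
  by rewrite -mulr_sumr exchange_big.
have -> : 2 ^+ n * (G * expR (lam ^+ 2 / (2 * n%:R))) =
    \sum_y W y * (G * (2 ^+ n * expR (lam ^+ 2 / (2 * n%:R)))).
  by rewrite -mulr_suml W1; ring.
apply: ler_sum => y _.
have [Wy|Wy] := eqVneq (W y) 0; first by rewrite Wy !mul0r.
rewrite ler_wpM2l//.
have {}/growth Gy j : 0 < p (y j).
  rewrite lt_neqAle p_ge0 andbT eq_sym.
  by move/prodf_neq0 : Wy; apply.
apply: (@le_trans _ _ (#|traces y|%:R * (2 ^+ n * expR (lam ^+ 2 / (2 * n%:R))))).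
  rewrite mulr_natl -sumr_const; apply: ler_sum => A _; exact: sum_signs.
by rewrite ler_wpM2r// mulr_ge0 ?expR_ge0 ?exprn_ge0.
Qed.

End symmetrization.

(** * Traces of unions of halfspaces *)

Definition shatters (I : finType) (F : {set {set I}}) (A : {set I}) : bool :=
  [forall B : {set I}, (B \subset A) ==> [exists C in F, C :&: A == B]].

Lemma shattersP (I : finType) (F : {set {set I}}) (A : {set I}) :
  reflect (forall B : {set I}, B \subset A ->
             exists2 C, C \in F & C :&: A = B) (shatters F A).
Proof.
apply: (iffP forallP) => [sFA B BA|sFA B].
  by have /implyP/(_ BA)/existsP[C /andP[CF /eqP]] := sFA B; exists C.
apply/implyP => /sFA[C CF <-]; apply/existsP; exists C.
by rewrite CF eqxx.
Qed.

Lemma shattersS (I : finType) (F G : {set {set I}}) (A : {set I}) :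
  F \subset G -> shatters F A -> shatters G A.
Proof.
move=> /fintype.subsetP FG /shattersP sFA; apply/shattersP => B /sFA[C CF <-].
by exists C => //; apply: FG.
Qed.

(* Pajor's form of the Sauer-Shelah lemma. *)
Lemma card_le_shattered (I : finType) (F : {set {set I}}) :
  (#|F| <= #|[set A | shatters F A]|)%N.
Proof.
have [k] := ubnP #|F|; elim: k F => // k IH F; rewrite ltnS => Fk.
have [->|[C CF]] := finset.set_0Vmem F; first by rewrite cards0.
have [FC|] := boolP (F \subset [set C]).
  apply: (leq_trans (subset_leq_card FC)); rewrite cards1 card_gt0.
  apply/finset.set0Pn; exists finset.set0; rewrite inE; apply/shattersP => B.
  by rewrite finset.subset0 => /eqP ->; exists C => //; rewrite finset.setI0.
case/subsetPn => C' C'F; rewrite inE => CC'.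
(* Splitting [F] by membership of a point that separates two of its members gives two strictly
   smaller families. *)
have [x Cx] : exists x, (x \in C) != (x \in C').
  apply/existsP; apply: contraNT CC'; rewrite negb_exists => /forallP H.
  by apply/eqP/finset.setP => x; apply/eqP; rewrite eq_sym -[_ == _]negbK H.
pose G (b : bool) := [set D in F | (x \in D) == b].
have Gs b : G b \subset F by apply/fintype.subsetP => D; rewrite inE => /andP[].
have Gk b : (#|G b| < k)%N.
  apply: leq_trans Fk; apply: proper_card; apply/fintype.properP; split => //.
  have [Cb|Cb] := eqVneq (x \in C) b; [exists C'|exists C] => //; rewrite !inE.
    by rewrite C'F -Cb eq_sym.
  by rewrite CF.
pose S (b : bool) := [set A | shatters (G b) A].
have Sx b A : A \in S b -> x \notin A.
  rewrite inE => /shattersP H; apply/negP => xA.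
  have [|D + DA] := H (if b then finset.set0 else A).
    by case: b {H} => //; apply: finset.sub0set.
  rewrite inE => /andP[_ /eqP Db].
  have : (x \in D :&: A) = b by rewrite inE xA andbT Db.
  by rewrite DA; case: b {H Db DA} => //; rewrite ?inE ?xA.
have cF : #|F| = (#|G true| + #|G false|)%N.
  rewrite -(cardsID [set D : {set I} | x \in D] F); congr (_ + _)%N; apply: eq_card => D;
    rewrite !inE ?eqb_id // eqbF_neg andbC //.
rewrite cF; apply: (leq_trans (leq_add (IH _ (Gk true)) (IH _ (Gk false)))).
(* Sets shattered by both halves are counted twice. The second count is matched by adding [x] to
   them: [F] shatters the result, and it is new because no set shattered by a half contains [x]. *)
rewrite -/(S true) -/(S false) -cardsUI.
have injx : {in S true :&: S false &, injective (fun A => x |: A)}.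
  move=> A B /finset.setIP[/Sx xA _] /finset.setIP[/Sx xB _] /(congr1 (fun A => A :\ x)).
  by rewrite !finset.setU1K.
rewrite -(card_in_imset injx).
have dis : [disjoint S true :|: S false & [set x |: A | A in S true :&: S false]].
  rewrite -finset.setI_eq0; apply/eqP/finset.setP => A; rewrite finset.in_set0.
  apply/negP => /finset.setIP[+ /imsetP[B _ AB]]; have xA : x \in A by rewrite AB finset.setU11.
  by case/finset.setUP => /Sx; rewrite xA.
move: (dis); rewrite -leq_card_setU => /eqP <-; apply: subset_leq_card.
apply/fintype.subsetP => A /finset.setUP[/finset.setUP[]|].
- by rewrite !inE; apply: shattersS.
- by rewrite !inE; apply: shattersS.
- case/imsetP => B /finset.setIP[BT BF ->{A}]; rewrite inE; apply/shattersP => E EB.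
  have xB := Sx _ _ BT.
  have EB' : E :\ x \subset B.
    apply/fintype.subsetP => y /finset.setD1P[yx /(fintype.subsetP EB)].
    by rewrite finset.in_setU1 (negbTE yx).
  have [D DG DB] : exists2 D, D \in G (x \in E) & D :&: B = E :\ x.
    by case: (x \in E); [move: BT|move: BF]; rewrite inE => /shattersP; apply.
  exists D; first exact: (fintype.subsetP (Gs _)) DG.
  move: DG; rewrite inE => /andP[_ /eqP xDE].
  rewrite finset.setIUr DB; apply/finset.setP => y; rewrite !inE.
  have [->|yx] := eqVneq y x; first by rewrite xDE andbT orbF.
  by rewrite andbF.
Qed.

Lemma sum_expr_card (R : comRingType) (I : finType) (x : R) :
  \sum_(A : {set I}) x ^+ #|A| = (1 + x) ^+ #|I|.
Proof.
rewrite addrC -cardsT -prodr_const.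
under [RHS]eq_bigl do rewrite inE.
rewrite bigA_distr; apply: eq_bigr => A _.
by rewrite -big_mkcond prodr_const.
Qed.

(** Weight each subset by [x ^+ #|A|] with [x = D / N <= 1]. Small subsets weigh at least [x ^+ D],
    while the total weight is [(1 + x) ^+ N <= expR (x * N) = expR D]. *)
Lemma card_small_subsets (R : realType) (I : finType) (D : nat) :
  (0 < D <= #|I|)%N ->
  #|[set A : {set I} | (#|A| <= D)%N]|%:R <=
    (expR 1 * #|I|%:R / D%:R) ^+ D :> R.
Proof.
move=> /andP[D0 DI]; set N := #|I|.
have N0 : (0 < N)%N by exact: leq_trans DI.
pose x : R := D%:R / N%:R.
have x0 : 0 < x by rewrite divr_gt0 ?ltr0n.
have x1 : x <= 1 by rewrite ler_pdivrMr ?ltr0n// mul1r ler_nat.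
have -> : expR 1 * N%:R / D%:R = expR 1 / x.
  by rewrite /x invfM invrK mulrA mulrAC.
rewrite expr_div_n ler_pdivlMr ?exprn_gt0//.
apply: (@le_trans _ _ (\sum_(A : {set I}) x ^+ #|A|)).
  rewrite -sum1_card natr_sum mulr_suml big_mkcond/=.
  apply: ler_sum => A _; rewrite inE; case: ifPn => AD; last first.
    by rewrite exprn_ge0// ltW.
  by rewrite mul1r ler_wiXn2l// ltW.
rewrite sum_expr_card -/N.
apply: (@le_trans _ _ (expR x ^+ N)).
  by apply: lerXn2r; rewrite ?nnegrE ?expR_ge0 ?addr_ge0 ?expR_ge1Dx// ltW.
by rewrite -!expRM_natr mul1r /x divfK// pnatr_eq0 -lt0n.
Qed.

(** More than [D] vectors in dimension [D] satisfy a linear relation [c]. A halfspace selecting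
    exactly the points with positive coefficient would make every term of the relation, evaluated at
    [w], nonpositive and one of them negative, although the sum is 0. *)
Lemma card_shattered_halfspaces (R : realType) (I : finType) (D : nat)
    (v : I -> 'rV[R]_D) (F : {set {set I}}) (A : {set I}) :
  (forall B, B \in F ->
     exists w : 'cV[R]_D, forall i, (i \in B) = ((v i *m w) 0 0 < 0)) ->
  shatters F A -> (#|A| <= D)%N.
Proof.
move=> HF /shattersP sFA; rewrite leqNgt; apply/negP => DA.
pose M : 'M[R]_(#|A|, D) := \matrix_(i < #|A|) v (enum_val i).
have [c c0 cM] : exists2 c : 'rV[R]_#|A|, c != 0 & c *m M = 0.
  have : kermx M != 0.
    rewrite kermx_eq0 /row_free neq_ltn.
    by rewrite (leq_ltn_trans (rank_leq_col M) DA).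
  by case/rowV0Pn => c /sub_kermxP cM c0; exists c.
(* Up to changing the sign of the relation, some coefficient is positive; this makes the final
   inequality strict. *)
have {c c0 cM} [c [i0 c0 cM]] :
    exists c : 'rV[R]_#|A|, exists2 i, 0 < c 0 i & c *m M = 0.
  have [i ci] : exists i, c 0 i != 0.
    apply/existsP; apply: contraNT c0; rewrite negb_exists => /forallP H.
    by apply/eqP/rowP => i; rewrite mxE; apply/eqP; rewrite -[_ == _]negbK H.
  have [ci0|ci0|ci0] := ltgtP (c 0 i) 0.
  - by exists (- c), i; rewrite ?mxE ?oppr_gt0 // mulNmx cM oppr0.
  - by exists c, i.
  - by rewrite ci0 eqxx in ci.
have [C CF CA] := sFA [set enum_val i | i in [pred i | 0 < c 0 i]]
  ltac:(by apply/fintype.subsetP => _ /imsetP[i _ ->]; apply: enum_valP).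
have [w Cw] := HF _ CF.
have Cc i : (enum_val i \in C) = (0 < c 0 i).
  have -> : (enum_val i \in C) = (enum_val i \in C :&: A).
    by rewrite inE enum_valP andbT.
  rewrite CA; apply/imsetP/idP => [[j jc /enum_val_inj ->//]|ci].
  by exists i.
have : (c *m M *m w) 0 0 = 0 by rewrite cM mul0mx mxE.
rewrite -mulmxA mxE => sum0.
have le0 i : c 0 i * (M *m w) i 0 <= 0.
  have -> : (M *m w) i 0 = (v (enum_val i) *m w) 0 0.
    by rewrite !mxE; apply: eq_bigr => j _; rewrite !mxE.
  have := Cw (enum_val i); rewrite Cc.
  case: ltP => [ci /esym vw|ci /esym/negbT]; first by rewrite mulr_ge0_le0// ltW.
  by rewrite -leNgt => vw; rewrite mulr_le0_ge0.
have : \sum_j c 0 j * (M *m w) j 0 < 0; last by rewrite sum0 ltxx.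
rewrite (bigD1 i0)//= -[ltRHS]addr0; apply: ltr_leD; last exact: sumr_le0.
rewrite pmulr_rlt0//.
have -> : (M *m w) i0 0 = (v (enum_val i0) *m w) 0 0.
  by rewrite !mxE; apply: eq_bigr => j _; rewrite !mxE.
by rewrite -Cw Cc.
Qed.

Definition halfspace (R : realType) (d : nat) (w : R * {ffun 'I_d -> R})
    (z : d.-tuple R) : bool :=
  w.1 + \sum_(i < d) w.2 i * tnth z i < 0.

Definition halfspace_union (R : realType) (d m : nat)
    (W : {ffun 'I_m -> R * {ffun 'I_d -> R}}) (z : d.-tuple R) : bool :=
  [exists j, halfspace (W j) z].

Lemma card_halfspace_traces (R : realType) (d : nat) (I : finType)
    (z : I -> d.-tuple R) (F : {set {set I}}) :
  (d.+1 <= #|I|)%N ->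
  (forall B, B \in F -> exists w, B = [set i | halfspace w (z i)]) ->
  #|F|%:R <= (expR 1 * #|I|%:R / d.+1%:R) ^+ d.+1 :> R.
Proof.
move=> dI FH; apply: le_trans (@card_small_subsets R I d.+1 _) => //.
rewrite ler_nat; apply: (leq_trans (card_le_shattered F)).
apply: subset_leq_card; apply/fintype.subsetP => A; rewrite !inE.
(* Homogeneous coordinates: a leading 1 turns affine halfspaces in dimension [d] into linear ones in
   dimension [d.+1]. *)
pose v i : 'rV[R]_d.+1 :=
  \row_k (if unlift ord0 k is Some j then tnth (z i) j else 1).
apply: (@card_shattered_halfspaces R I d.+1 v) => B /FH[w ->].
exists (\col_k (if unlift ord0 k is Some j then w.2 j else w.1)) => i.
rewrite inE /halfspace mxE big_ord_recl !mxE unlift_none mul1r.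
congr (_ + _ < 0); apply: eq_bigr => j _.
by rewrite !mxE liftK mulrC.
Qed.

(** The trace of a union is the union of [m] halfspace traces, so there are at most as many as
    [m]-tuples of halfspace traces. *)
Lemma card_halfspace_union_traces (R : realType) (d m : nat) (I : finType)
    (z : I -> d.-tuple R) (F : {set {set I}}) :
  (d.+1 <= #|I|)%N ->
  (forall B, B \in F ->
     exists W : {ffun 'I_m -> _}, B = [set i | halfspace_union W (z i)]) ->
  #|F|%:R <= (expR 1 * #|I|%:R / d.+1%:R) ^+ (d.+1 * m) :> R.
Proof.
move=> dI FH.
pose H := [set B : {set I} | `[< exists w, B = [set i | halfspace w (z i)] >]].
have HE B : B \in H -> exists w, B = [set i | halfspace w (z i)].
  by rewrite inE => /asboolP.
apply: (@le_trans _ _ (#|H|%:R ^+ m)).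
  rewrite -natrX ler_nat.
  have := card_ffun_on 'I_m (mem H); rewrite card_ord => <-.
  apply: leq_trans (leq_imset_card (fun h : {ffun 'I_m -> {set I}} =>
    \bigcup_j h j) _).
  apply: subset_leq_card; apply/fintype.subsetP => B /FH[W ->].
  apply/imsetP; exists [ffun j => [set i | halfspace (W j) (z i)]].
    apply/ffun_onP => j; rewrite ffunE inE; apply/asboolP.
    by exists (W j).
  apply/finset.setP => i; rewrite inE; apply/existsP/finset.bigcupP => [[j Wj]|[j _]].
    by exists j => //; rewrite ffunE inE.
  by rewrite ffunE inE => Wj; exists j.
have cardH := card_halfspace_traces dI HE.
by rewrite exprM lerXn2r ?nnegrE ?ler0n// (le_trans _ cardH).
Qed.

(** * Empirical deviations of a countable family of events *)

Local Open Scope classical_set_scope.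

Section finite_valued.
Context (R : realType) (dT : measure_display) (T : measurableType dT).
Context (E : finType) (h : T -> E).
Hypothesis mh : forall e, measurable (h @^-1` [set e]).

Let preimage_seq (r : seq E) :
  [set w | h w \in r] = \big[setU/set0]_(e <- r) (h @^-1` [set e]).
Proof.
rewrite -bigcup_seq; apply/seteqP; split => [w hw|w [e er /= ->//]].
by exists (h w).
Qed.

Lemma measurable_preimage_pred (Q : pred E) : measurable [set w | Q (h w)].
Proof.
rewrite (_ : [set w | Q (h w)] = [set w | h w \in enum Q]).
  by rewrite preimage_seq; apply: bigsetU_measurable.
by apply/seteqP; split => w /=; rewrite mem_enum.
Qed.

Lemma fine_preimage_pred (P : probability T R) (Q : pred E) :
  fine (P [set w | Q (h w)]) = \sum_(e | Q e) fine (P (h @^-1` [set e])).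
Proof.
rewrite (_ : [set w | Q (h w)] = [set w | h w \in enum Q]); last first.
  by apply/seteqP; split => w /=; rewrite mem_enum.
rewrite -[RHS]big_enum.
have : uniq (enum Q) by exact: enum_uniq.
elim: (enum Q) => [_|e r IH]; last rewrite cons_uniq => /andP[er ur].
  by rewrite preimage_seq !big_nil measure0.
rewrite big_cons -IH// preimage_seq big_cons -preimage_seq.
rewrite measureU//.
- by rewrite fineD// fin_num_measure// preimage_seq; apply: bigsetU_measurable.
- by rewrite preimage_seq; apply: bigsetU_measurable.
- apply/seteqP; split => // w [/= -> ]; by apply/negP.
Qed.

End finite_valued.

Section empirical.
Context (R : realType) (d n : nat) (dT : measure_display) (T : measurableType dT).
Context (P : probability T R) (mu : probability (d.-tuple R) R).
Context (Z : 'I_n -> T -> d.-tuple R).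
Hypotheses (iidZ : iid_with_law P mu Z) (n_gt0 : (0 < n)%N).

Definition gap (f : d.-tuple R -> bool) (w : T) : R :=
  fine (mu [set z | f z]) - n%:R^-1 * \sum_(i < n) (f (Z i w))%:R.

Section finite_family.
Context (K : finType) (F : K -> d.-tuple R -> bool).
Hypothesis mF : forall k, measurable [set z | F k z].

(** A point is reduced to its truth vector under the family. The fibres of [phi] are the atoms, [p]
    is the law of the atom under [mu], and [Phi] reads the sample atom by atom. *)
Let E := {ffun K -> bool}.
Let phi (z : d.-tuple R) : E := [ffun k => F k z].
Let Phi (w : T) : {ffun 'I_n -> E} := [ffun i => phi (Z i w)].
Let p (e : E) : R := fine (mu (phi @^-1` [set e])).

Let mphi e : measurable (phi @^-1` [set e]).
Proof.
rewrite (_ : _ @^-1` _ = \bigcap_(k in [set: K]) [set z | F k z = e k]).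
  apply: fin_bigcap_measurable => // k _.
  case: (e k).
    by rewrite (_ : [set z | F k z = true] = [set z | F k z])//.
  rewrite (_ : [set z | F k z = false] = ~` [set z | F k z]).
    exact: measurableC.
  by apply/seteqP; split => z /=; [move=> ->|move/negP/negbTE].
apply/seteqP; split => z /=.
  by move=> <- k _; rewrite ffunE.
by move=> ze; apply/ffunP => k; rewrite ffunE; apply: ze.
Qed.

Let PhiE x : Phi @^-1` [set x] =
  \bigcap_(i in [set: 'I_n]) (Z i @^-1` (phi @^-1` [set x i])).
Proof.
apply/seteqP; split => w /=; first by move=> <- i _; rewrite /= ffunE.
by move=> H; apply/ffunP => i; rewrite ffunE; apply: H.
Qed.

Let mPhi x : measurable (Phi @^-1` [set x]).
Proof.
rewrite PhiE; apply: fin_bigcap_measurable => // i _.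
have [mZ _] := iidZ.
by rewrite -[X in measurable X]setTI; apply: mZ.
Qed.

Let PPhi x : fine (P (Phi @^-1` [set x])) = \prod_i p (x i).
Proof.
rewrite PhiE; have [_ [lawZ indepZ]] := iidZ.
by rewrite indepZ//; apply: eq_bigr => i _; rewrite lawZ.
Qed.

Let gapE k w : gap (F k) w = - deviation p (fun k (e : E) => e k) k (Phi w).
Proof.
rewrite /gap /deviation opprB; congr (_ - _ * _).
  rewrite (_ : [set z | F k z] = [set z | phi z k]).
    rewrite (fine_preimage_pred mphi mu (fun e => e k)) big_mkcond/=.
    by apply: eq_bigr => e _; case: (e k); rewrite ?mulr1 ?mulr0.
  by apply/seteqP; split => z /=; rewrite ffunE.
by apply: eq_bigr => i _; rewrite !ffunE.
Qed.

Let bad (eps : R) : pred {ffun 'I_n -> E} :=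
  fun x => [exists k, eps < `|deviation p (fun k (e : E) => e k) k x| ].

Let badE eps : [set w | exists k, eps < `|gap (F k) w| ] = [set w | bad eps (Phi w)].
Proof.
apply/seteqP; split => w /=.
  by case=> k; rewrite gapE normrN => ek; apply/existsP; exists k.
by move=> /existsP[k ek]; exists k; rewrite gapE normrN.
Qed.

Lemma measurable_gap_gt (eps : R) :
  measurable [set w | exists k, eps < `|gap (F k) w| ].
Proof. by rewrite badE; apply: measurable_preimage_pred. Qed.

Lemma prob_gap_gt_finite (eps G : R) : 0 <= eps ->
  (forall z : 'I_n * bool -> d.-tuple R,
     #|[set [set j | F k (z j)]%SET | k : K]%SET|%:R <= G) ->
  fine (P [set w | exists k, eps < `|gap (F k) w| ]) <=
    2 * G * expR (- (n%:R * eps ^+ 2 / 2)).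
Proof.
move=> eps0 growth; rewrite badE fine_preimage_pred//.
under eq_bigr do rewrite PPhi.
have p0 e : 0 <= p e by rewrite fine_ge0.
have p1 : \sum_e p e = 1.
  rewrite -(fine_preimage_pred mphi mu xpredT) -[RHS]/(fine 1%:E).
  congr fine; rewrite -(probability_setT mu); congr (mu _).
  by apply/seteqP; split.
pose f := fun k (e : E) => e k.
have growthE (y : {ffun 'I_n * bool -> E}) :
    (forall j, 0 < p (y j)) -> #|traces f y|%:R <= G.
  move=> py.
  (* An atom of positive mass is nonempty, so traces on atoms are traces on actual points, where
     [growth] applies. *)
  have ex j : exists z, phi z = y j.
    apply: contrapT => nz; have := py j.
    rewrite /p (_ : _ @^-1` _ = set0) ?measure0 ?ltxx//.
    by apply/seteqP; split => // z yz; apply: nz; exists z.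
  have [z zy] := choice ex.
  rewrite (_ : traces f y = [set [set j | F k (z j)]%SET | k : K]%SET)//.
  apply: eq_imset => k; apply/finset.setP => j; rewrite !inE /f -zy ffunE//.
have n0 : n%:R != 0 :> R by rewrite pnatr_eq0 -lt0n.
(* The Chernoff parameter [n * eps] minimises [- lam * eps + lam ^+ 2 / (2 * n)], with value
   [- n * eps ^+ 2 / 2]. The sign [s] selects the side of the deviation. *)
have tail s := symmetrization_tail (f := f) p0 p1 n_gt0
  (s * (n%:R * eps)) (n%:R * eps ^+ 2) growthE.
have bound s : s ^+ 2 = 1 -> expR (- (n%:R * eps ^+ 2)) * G *
    expR ((s * (n%:R * eps)) ^+ 2 / (2 * n%:R)) = G * expR (- (n%:R * eps ^+ 2 / 2)).
  move=> s2; rewrite mulrAC mulrC -expRD; congr (_ * expR _).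
  by rewrite exprMn s2; field.
apply: (@le_trans _ _ (
  \sum_(x : {ffun 'I_n -> E} | [exists k, n%:R * eps ^+ 2 <=
      (1 * (n%:R * eps)) * deviation p f k x]) \prod_i p (x i) +
  \sum_(x : {ffun 'I_n -> E} | [exists k, n%:R * eps ^+ 2 <=
      (- 1 * (n%:R * eps)) * deviation p f k x]) \prod_i p (x i))).
  rewrite (big_mkcond (bad eps)) [X in _ <= X + _]big_mkcond.
  rewrite [X in _ <= _ + X]big_mkcond -big_split/=; apply: ler_sum => x _.
  have w0 : 0 <= \prod_i p (x i) by exact: prodr_ge0.
  case: ifPn => [/existsP[k]|_]; last by rewrite addr_ge0//; case: ifP.
  rewrite ltr_normr => /orP[] ek.
    rewrite [X in _ <= X + _]ifT.
      by rewrite lerDl; case: ifP.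
    apply/existsP; exists k; rewrite mul1r expr2 mulrA ler_wpM2l ?mulr_ge0//.
    exact: ltW.
  rewrite [X in _ <= _ + X]ifT.
    by rewrite lerDr; case: ifP.
  apply/existsP; exists k.
  rewrite mulN1r mulNr -mulrN expr2 mulrA ler_wpM2l ?mulr_ge0//.
  exact: ltW.
have := lerD (tail 1) (tail (- 1)); rewrite !bound ?sqrrN ?expr1n//.
by move=> /le_trans; apply; rewrite -[leRHS]mulrA [leRHS]mulr_natl mulr2n.
Qed.

End finite_family.

(** The bad events of the first [K] members increase with [K], and their probabilities have a bound
    independent of [K], which passes to the union by continuity from below. *)
Lemma prob_gap_le_countable (F : nat -> d.-tuple R -> bool) (eps G : R) :
  (forall k, measurable [set z | F k z]) -> 0 <= eps ->
  (forall K (z : 'I_n * bool -> d.-tuple R),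
     #|[set [set j | F k (z j)]%SET | k : 'I_K]%SET|%:R <= G) ->
  exists A : set T, [/\ measurable A,
    ((1 - 2 * G * expR (- (n%:R * eps ^+ 2 / 2)))%:E <= P A)%E &
    forall w, A w -> forall k, `|gap (F k) w| <= eps].
Proof.
move=> mF eps0 growth.
pose bad K := [set w | exists k : 'I_K, eps < `|gap (F k) w| ].
have mbad K : measurable (bad K).
  exact: (measurable_gap_gt (F := fun k : 'I_K => F k)).
have mU : measurable (\bigcup_K bad K) by exact: bigcupT_measurable.
have ndbad : nondecreasing_seq bad.
  move=> K L KL; apply/subsetPset => w [k ek].
  by exists (widen_ord KL k).
have cvgbad := nondecreasing_cvg_mu (mu := P) mbad mU ndbad.
have PU : (P (\bigcup_K bad K) <= (2 * G * expR (- (n%:R * eps ^+ 2 / 2)))%:E)%E.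
  rewrite -(cvg_lim _ cvgbad)//; apply: lime_le.
    by apply/cvg_ex; eexists; exact: cvgbad.
  apply: nearW => K /=.
  rewrite -[P (bad K)]fineK ?fin_num_measure// lee_fin.
  exact: (prob_gap_gt_finite (F := fun k : 'I_K => F k)).
exists (~` \bigcup_K bad K); split.
- exact: measurableC.
- rewrite probability_setC// EFinB leeB//.
- move=> w nbad k; rewrite leNgt; apply/negP => ek; apply: nbad.
  by exists k.+1 => //; exists ord_max.
Qed.

End empirical.

(** * Approximation by rational halfspaces *)

Lemma measurable_halfspace_union (R : realType) (d m : nat)
    (W : {ffun 'I_m -> R * {ffun 'I_d -> R}}) :
  measurable [set z | halfspace_union W z].
Proof.
rewrite (_ : [set z | _] = \bigcup_(j in [set: 'I_m]) [set z | halfspace (W j) z]).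
  apply: fin_bigcup_measurable => // j _.
  rewrite -[X in measurable X]setTI -[X in _ `&` X]preimage_true.
  suff: measurable_fun [set: d.-tuple R] (halfspace (W j)) by apply.
  apply: measurable_fun_ltr => //; apply: measurable_funD => //.
  apply: measurable_sum => i; apply: measurable_funM => //.
  exact: measurable_tnth.
apply/seteqP; split => z /=.
  by move=> /existsP[j zj]; exists j.
by move=> [j _ zj]; apply/existsP; exists j.
Qed.

Definition ratr_params (R : realType) (d : nat) (q : rat * {ffun 'I_d -> rat}) :
    R * {ffun 'I_d -> R} :=
  (ratr q.1, [ffun i => ratr (q.2 i)]).

(* Perturbing the offset upwards by order 1/k and the normal only by order
   1/k^2 keeps boundary points of the open halfspace outside. *)
Lemma halfspace_rat_approx (R : realType) (d : nat) (w : R * {ffun 'I_d -> R}) :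
  exists q : nat -> rat * {ffun 'I_d -> rat}, forall z,
    \forall k \near \oo, halfspace (ratr_params R (q k)) z = halfspace w z.
Proof.
pose e k : R := k.+1%:R^-1.
have e0 k : 0 < e k by rewrite invr_gt0.
have /choice[qa qaP] : forall k, exists q : rat,
    w.1 + e k < ratr q < w.1 + 2 * e k.
  move=> k.
  have [|q] := @rat_in_itvoo R (w.1 + e k) (w.1 + 2 * e k).
    by have := e0 k; lra.
  by rewrite in_itv; exists q.
have /choice[qb qbP] : forall ki : nat * 'I_d, exists q : rat,
    w.2 ki.2 < ratr q < w.2 ki.2 + e ki.1 ^+ 2.
  move=> [k i] /=.
  have [|q] := @rat_in_itvoo R (w.2 i) (w.2 i + e k ^+ 2).
    by rewrite ltrDl exprn_gt0.
  by rewrite in_itv; exists q.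
exists (fun k => (qa k, [ffun i => qb (k, i)])) => z.
pose B : R := \sum_(i < d) `|tnth z i|.
have B0 : 0 <= B by rewrite sumr_ge0.
pose v := w.1 + \sum_(i < d) w.2 i * tnth z i.
(* The margin for the perturbation. If [v < 0], the total change is at most [e k * (2 + B)], which
   must stay below [- v]. If [v >= 0], the value 1 forces [e k ^+ 2 * B <= e k], so the rise of the
   offset outweighs the change of the normal. *)
pose c : R := if v < 0 then - v else 1.
have c0 : 0 < c by rewrite /c; case: (ltP v 0) => // v0; rewrite oppr_gt0.
have c20 : 0 < c / (2 + B) by rewrite divr_gt0// ltr_wpDr.
near=> k.
have ek : e k * (2 + B) < c.
  rewrite -ltr_pdivlMr ?ltr_wpDr//; near: k.
  exact: (near_infty_natSinv_lt (PosNum c20)).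
have e1 : e k <= 1 by rewrite invf_le1// ler1n.
rewrite /halfspace -/v /=.
set vk := ratr (qa k) + _.
have vkE : vk = v + (ratr (qa k) - w.1) +
    \sum_(i < d) (ratr (qb (k, i)) - w.2 i) * tnth z i.
  rewrite /vk /v; under eq_bigr do rewrite !ffunE.
  under [X in _ = _ + X]eq_bigr do rewrite mulrBl.
  by rewrite sumrB; ring.
have : `|\sum_(i < d) (ratr (qb (k, i)) - w.2 i) * tnth z i| <= e k ^+ 2 * B.
  apply: (le_trans (ler_norm_sum _ _ _)); rewrite mulr_sumr; apply: ler_sum => i _.
  rewrite normrM ler_wpM2r// ger0_norm; have := qbP (k, i) => /=; lra.
rewrite ler_norml; have := qaP k => /andP[qa1 qa2] /andP[s1 s2].
have e2B : e k ^+ 2 * B <= e k * B.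
  by rewrite expr2 -mulrA ler_piMl// mulr_ge0// ltW.
move: ek; rewrite /c mulrDr; case: (ltP v 0) => v0 ek.
  by rewrite vkE; apply/idP; lra.
apply/negbTE; rewrite -leNgt vkE.
have eB : e k * B <= 1 by have := e0 k; lra.
have : e k ^+ 2 * B <= e k by rewrite expr2 -mulrA ler_piMr// ltW.
lra.
Unshelve. all: by end_near. Qed.

Lemma halfspace_union_rat_approx (R : realType) (d m : nat)
    (W : {ffun 'I_m -> R * {ffun 'I_d -> R}}) :
  exists q : nat -> {ffun 'I_m -> rat * {ffun 'I_d -> rat}}, forall z,
    \forall k \near \oo,
      halfspace_union [ffun j => ratr_params R (q k j)] z = halfspace_union W z.
Proof.
have [q qP] := choice (fun j => halfspace_rat_approx (W j)).
exists (fun k => [ffun j => q j k]) => z.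
have : \forall k \near \oo, forall j,
    halfspace (ratr_params R (q j k)) z = halfspace (W j) z.
  by apply: filter_forall => j; exact: qP.
apply: filterS => k kz; apply: eq_existsb => j.
by rewrite !ffunE kz.
Qed.

(** * Limits of probabilities and gaps along pointwise convergent events *)

Section pred_measure.
Context (R : realType) (dT : measure_display) (T : measurableType dT).
Context (mu : probability T R).

Lemma integral_pred (f : T -> bool) : measurable [set z | f z] ->
  (\int[mu]_z (f z)%:R%:E = mu [set z | f z])%E.
Proof.
move=> mf; rewrite -[in RHS](setIT [set z | f z]) -integral_indic//.
apply: eq_integral => z _.
by rewrite indicE mem_setE.
Qed.

Lemma integrable_pred (f : T -> bool) : measurable [set z | f z] ->
  mu.-integrable setT (fun z => (f z)%:R%:E).
Proof.
move=> mf; rewrite (_ : (fun z => _) = EFin \o \1_[set z | f z]).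
  exact: integrable_indic.
by apply/funext => z /=; rewrite indicE mem_setE.
Qed.

Lemma cvg_measure_pred (f : T -> bool) (f_ : nat -> T -> bool) :
  measurable [set z | f z] -> (forall k, measurable [set z | f_ k z]) ->
  (forall z, \forall k \near \oo, f_ k z = f z) ->
  fine (mu [set z | f_ k z]) @[k --> \oo] --> fine (mu [set z | f z]).
Proof.
move=> mf mf_ ff.
have cvg : (\int[mu]_z (f_ k z)%:R%:E @[k --> \oo] --> \int[mu]_z (f z)%:R%:E)%E.
  apply: (@dominated_cvg _ _ _ mu setT measurableT _ _ (cst 1%E)) => //.
  - by move=> k; have /integrableP[] := integrable_pred (mf_ k).
  - move=> z _; apply: cvg_near_cst; apply: filterS (ff z) => k ->.
    by [].
  - exact: (finite_measure_integrable_cst mu 1 measurableT).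
  - by move=> k z _; rewrite gee0_abs ?lee_fin//; case: (f_ k z).
apply: fine_cvg; rewrite fineK ?fin_num_measure// -integral_pred//.
by under eq_cvg do rewrite -integral_pred//.
Qed.

End pred_measure.

(** The true probabilities converge by dominated convergence. The empirical frequencies are
    eventually constant, because only [n] points matter once [w] is fixed. *)
Lemma gap_le_lim (R : realType) (d n : nat) (dT : measure_display)
    (T : measurableType dT) (mu : probability (d.-tuple R) R)
    (Z : 'I_n -> T -> d.-tuple R) (f : d.-tuple R -> bool)
    (f_ : nat -> d.-tuple R -> bool) (w : T) (eps : R) :
  measurable [set z | f z] -> (forall k, measurable [set z | f_ k z]) ->
  (forall z, \forall k \near \oo, f_ k z = f z) ->
  (forall k, `|gap mu Z (f_ k) w| <= eps) -> `|gap mu Z f w| <= eps.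
Proof.
move=> mf mf_ ff gap_le.
have cvg : `|gap mu Z (f_ k) w| @[k --> \oo] --> `|gap mu Z f w|.
  apply: cvg_norm; apply: cvgB; first exact: cvg_measure_pred.
  apply: cvg_near_cst.
  have : \forall k \near \oo, forall i, f_ k (Z i w) = f (Z i w).
    by apply: filter_forall => i; exact: ff.
  by apply: filterS => k fk; under eq_bigr do rewrite fk.
rewrite -(cvg_lim _ cvg)//; apply: limr_le.
  by apply/cvg_ex; eexists; exact: cvg.
exact: nearW.
Qed.

(** * Decoding errors *)

Definition error_params (R : realType) (d m : nat) (C : 'I_m -> 'cV[R]_d)
    (S : 'M[R]_d) (j : 'I_m) : {ffun 'I_m -> R * {ffun 'I_d -> R}} :=
  [ffun j' => (sqnormS S (C j - C j'),
               [ffun i => 2 * ((C j - C j')^T *m S) 0 i])].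

(* The halfspace of index [j' = j] is [0 < 0], so it can be added freely. *)
Lemma loss_jE (R : realType) (d m : nat) (C : 'I_m -> 'cV[R]_d)
    (S : 'M[R]_d) (j : 'I_m) (z : d.-tuple R) :
  loss_j C S j z = (halfspace_union (error_params C S j) z)%:R.
Proof.
have bilinE v : 2 * bilin S v (tcol z) =
    \sum_(i < d) (2 * (v^T *m S) 0 i) * tnth z i.
  rewrite /bilin mxE mulr_sumr; apply: eq_bigr => i _.
  by rewrite [tcol z _ _]mxE mulrA.
rewrite /loss_j; congr (_%:R); congr nat_of_bool.
apply: eq_existsb => j'; rewrite ffunE /halfspace /=.
under eq_bigr do rewrite ffunE.
rewrite -bilinE; have [->|//] := eqVneq j' j.
by rewrite subrr /sqnormS /bilin trmx0 !mul0mx !mxE mulr0 addr0 ltxx.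
Qed.

Lemma Pe_gapE (R : realType) (d m n : nat) (dT : measure_display)
    (T : measurableType dT) (mu : probability (d.-tuple R) R)
    (Z : 'I_n -> T -> d.-tuple R) (C : 'I_m -> 'cV[R]_d) (S : 'M[R]_d) (w : T) :
  Pe_mu mu C S - Pe_emp (fun i => Z i w) C S =
  m%:R^-1 * \sum_(j < m) gap mu Z (halfspace_union (error_params C S j)) w.
Proof.
pose U j := halfspace_union (error_params C S j).
have mU j : measurable [set z | U j z] by exact: measurable_halfspace_union.
have lossE z : loss C S z = m%:R^-1 * \sum_(j < m) (U j z)%:R.
  by rewrite /loss; under eq_bigr do rewrite loss_jE.
have sumE : EFin \o (fun z => \sum_(j < m) (U j z)%:R) =
    (fun z => \sum_(j < m) (U j z)%:R%:E)%E :> (_ -> \bar R).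
  by apply/funext => z /=; rewrite sumEFin.
rewrite /gap sumrB mulrBr; congr (_ - _).
  rewrite /Pe_mu (eq_Rintegral _ (fun z _ => lossE z)).
  rewrite RintegralZl//; last first.
    by rewrite sumE; apply: integrable_sum => // j _; exact: integrable_pred.
  congr (_ * _); rewrite /Rintegral.
  have /= -> := (congr1 (fun f => \int[mu]_z f z)%E sumE).
  rewrite integral_sum//; last by move=> j; exact: integrable_pred.
  rewrite (eq_bigr (fun j => (fine (mu [set z | U j z]))%:E)) ?sumEFin// => j _.
  by rewrite integral_pred// fineK// fin_num_measure.
rewrite /Pe_emp (eq_bigr _ (fun i _ => lossE (Z i w))) -mulr_sumr mulrCA.
by congr (_ * _); rewrite exchange_big mulr_sumr.
Qed.

(** * Numerical form of the tail bound, and conclusion *)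

Lemma tail_bound_le (R : realType) (d m n : nat) (delta eps : R) :
  (2 <= m)%N -> (d.+1 <= n)%N -> 0 < delta < 1 ->
  eps =
    4 * m%:R * Num.sqrt (2 * d.+1%:R * ln (expR 1 * n%:R / d.+1%:R) / n%:R)
    + Num.sqrt (2 * ln (2 / delta) / n%:R) ->
  2 * (expR 1 * (n * 2)%:R / d.+1%:R) ^+ (d.+1 * m) *
    expR (- (n%:R * eps ^+ 2 / 2)) <= delta.
Proof.
move=> m2 dn /andP[delta0 delta1] epsE.
set D : R := d.+1%:R; set N : R := n%:R; set M : R := m%:R.
have D0 : 0 < D by rewrite ltr0n.
have N0 : 0 < N by rewrite ltr0n (leq_trans _ dn).
have DN : D <= N by rewrite ler_nat.
have M2 : 2 <= M by rewrite ler_nat.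
pose q : R := expR 1 * N / D.
have e2 : 2 <= expR 1 :> R by have := expR_ge1Dx (1 : R); lra.
have q2 : 2 <= q.
  rewrite /q -mulrA (le_trans e2)// ler_peMr ?expR_ge0//.
  by rewrite ler_pdivlMr// mul1r.
have q0 : 0 < q by lra.
pose L := ln q.
have L0 : 0 <= L by rewrite ln_ge0//; lra.
have qL : q = expR L by rewrite lnK.
pose t := ln (2 / delta).
have dt : 1 < 2 / delta by rewrite ltr_pdivlMr//; lra.
have t0 : 0 <= t by rewrite ln_ge0// ltW.
(* The factor 2 from the double sample is absorbed by [2 <= q], since then
   [q * 2 <= q ^+ 2 = expR (2 * L)]. *)
have growth : (expR 1 * (n * 2)%:R / D) ^+ (d.+1 * m) <= expR (2 * L * (D * M)).
  have -> : expR 1 * (n * 2)%:R / D = q * 2 by rewrite natrM /q -/N; field; lra.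
  rewrite -natrM expRM_natr lerXn2r ?nnegrE ?expR_ge0//; first by lra.
  by rewrite mulrDl !mul1r expRD -qL ler_wpM2l// ltW.
(* Squaring [eps] and dropping the nonnegative cross term separates a part that pays for the growth
   from [t], which pays for [delta]. *)
have exponent : 16 * M ^+ 2 * D * L + t <= N * eps ^+ 2 / 2.
  set a := 2 * D * L / N; set b := 2 * t / N.
  have a0 : 0 <= a by rewrite !mulr_ge0 ?invr_ge0// ltW.
  have b0 : 0 <= b by rewrite !mulr_ge0 ?invr_ge0// ltW.
  have -> : 16 * M ^+ 2 * D * L + t = N * (16 * M ^+ 2 * a + b) / 2.
    by rewrite /a /b; field; lra.
  apply: ler_wpM2r; first by rewrite invr_ge0.
  apply: ler_wpM2l; first exact: ltW.
  rewrite epsE -/D -/N -/M -/L -/a -/t -/b.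
  have := sqrtr_ge0 a; have := sqrtr_ge0 b.
  have := sqr_sqrtr a0; have := sqr_sqrtr b0.
  move: (Num.sqrt a) (Num.sqrt b) => u v <- <- v0 u0; rewrite -subr_ge0.
  have -> : (4 * M * u + v) ^+ 2 - (16 * M ^+ 2 * u ^+ 2 + v ^+ 2) =
      8 * M * u * v by ring.
  by rewrite !mulr_ge0//; lra.
have Et : expR (- t) = delta / 2.
  by rewrite expRN lnK ?posrE ?invf_div//; apply: lt_trans dt.
apply: (@le_trans _ _ (2 * expR (2 * L * (D * M)) *
    expR (- (16 * M ^+ 2 * D * L + t)))).
  apply: ler_pM; rewrite ?expR_ge0//.
  - rewrite mulr_ge0// exprn_ge0// divr_ge0// mulr_ge0 ?expR_ge0//.
  - by rewrite ler_wpM2l.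
  - by rewrite ler_expR lerN2.
rewrite opprD expRD Et.
have -> : forall x y : R, 2 * x * (y * (delta / 2)) = x * y * delta.
  by move=> x y; field.
(* It remains to compare [2 * M] with [16 * M ^+ 2], the coefficients of [D * L] in the two
   exponents. *)
rewrite -expRD; apply: ler_piMl; first exact: ltW.
rewrite expR_le1 subr_le0.
have DL : 0 <= D * L by rewrite mulr_ge0// ltW.
have -> : 2 * L * (D * M) = 2 * M * (D * L) by ring.
rewrite -[leRHS]mulrA ler_wpM2r//; nra.
Qed.

Theorem theorem1 (R : realType) (d m n : nat) (dT : measure_display)
    (T : measurableType dT) (P : probability T R)
    (mu : probability (d.-tuple R) R) (Z : 'I_n -> T -> d.-tuple R) :
  (0 < d)%N -> (2 <= m)%N -> (d.+1 <= n)%N ->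
  iid_with_law P mu Z ->
  forall delta : R, 0 < delta < 1 ->
  exists A : set T, measurable A /\ ((1 - delta)%:E <= P A)%E /\
    forall w, A w ->
      forall (C : 'I_m -> 'cV[R]_d) (S : 'M[R]_d), posdef S ->
        `| Pe_mu mu C S - Pe_emp (fun i => Z i w) C S | <=
          4 * m%:R * Num.sqrt (2 * d.+1%:R * ln (expR 1 * n%:R / d.+1%:R) / n%:R)
          + Num.sqrt (2 * ln (2 / delta) / n%:R).
Proof.
move=> _ m2 dn iidZ delta delta01.
set eps := 4 * m%:R * Num.sqrt (2 * d.+1%:R * ln (expR 1 * n%:R / d.+1%:R) / n%:R)
           + Num.sqrt (2 * ln (2 / delta) / n%:R).
have n0 : (0 < n)%N by exact: leq_trans dn.
have eps0 : 0 <= eps by rewrite addr_ge0 ?mulr_ge0 ?sqrtr_ge0.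
pose W (q : {ffun 'I_m -> rat * {ffun 'I_d -> rat}}) :
  {ffun 'I_m -> R * {ffun 'I_d -> R}} := [ffun j => ratr_params R (q j)].
(* Default for indices that encode no parameters; it too gives a rational union of halfspaces, so
   the bounds hold for every [F k]. *)
pose q0 : {ffun 'I_m -> rat * {ffun 'I_d -> rat}} := [ffun=> (0, [ffun=> 0])].
pose F (k : nat) := halfspace_union (W (odflt q0 (unpickle k))).
have growth K (z : 'I_n * bool -> d.-tuple R) :
    #|[set [set j | F k (z j)]%SET | k : 'I_K]%SET|%:R <=
    (expR 1 * (n * 2)%:R / d.+1%:R) ^+ (d.+1 * m) :> R.
  have cardJ : #|{: 'I_n * bool}| = (n * 2)%N by rewrite card_prod card_ord card_bool.
  rewrite -cardJ; apply: (card_halfspace_union_traces (z := z)).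
    by rewrite cardJ (leq_trans dn)// leq_pmulr.
  by move=> B /imsetP[k _ ->]; exists (W (odflt q0 (unpickle k))).
have mF k : measurable [set z | F k z] by exact: measurable_halfspace_union.
have [A [mA PA Agap]] := prob_gap_le_countable iidZ n0 mF eps0 growth.
exists A; split => //; split.
  by apply: le_trans PA; rewrite lee_fin lerB// tail_bound_le.
move=> w Aw C S _.
(* On the good event every rational union satisfies the bound, and pointwise limits extend it to all
   real parameters, hence to all codebooks and matrices at once. *)
have gap_le (V : {ffun 'I_m -> R * {ffun 'I_d -> R}}) :
    `|gap mu Z (halfspace_union V) w| <= eps.
  have [q qP] := halfspace_union_rat_approx V.
  apply: gap_le_lim qP _ => [|k|k]; try exact: measurable_halfspace_union.
  by have := Agap w Aw (pickle (q k)); rewrite /F pickleK.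
(* The error gap is the average of [m] gaps, each at most [eps]. *)
rewrite Pe_gapE normrM ger0_norm ?invr_ge0//.
have m0 : 0 < m%:R :> R by rewrite ltr0n (leq_trans _ m2).
rewrite mulrC ler_pdivrMr// (le_trans (ler_norm_sum _ _ _))//.
rewrite (le_trans (ler_sum _ (fun j _ => gap_le _)))//.
by rewrite sumr_const card_ord mulr_natr.
Qed.
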